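(* Let $\{\zeta_k(s)\}$ be an asymptotically exact family of zeta functions over $\mathbb{F}_q$ with essential weight $w_{\mathbf e}$, essential parts $\zeta_{\mathbf e,k}$ and limit zeta function $\zeta_{\lim}$. Then for every $s$ with $\Re s>\frac{w_{\mathbf e}}{2}$, $$\lim_{k\to\infty}\frac{\log\zeta_{\mathbf e,k}(s)}{\tilde d_k}=\log\zeta_{\lim}(s).$$ If moreover $2\Re s\notin\mathbb{Z}$, then $$\lim_{k\to\infty}\frac{\log\zeta_k(s)}{\tilde d_k}=\log\zeta_{\lim}(s).$$ The convergence is uniform in any domain $\frac{w_{\mathbf e}}{2}+\varepsilon<\Re s<\frac{w_{\mathbf e}+1}{2}-\varepsilon$ with $\varepsilon\in(0,\frac12)$.
   Context: Fix a prime power $q$. An $L$-function over $\mathbb{F}_q$ of weight $w$ is a holomorphic function $L(s)$ such that, with $u=q^{-s}$, $L(s)=\mathcal{L}(u)$ for a polynomial $\mathcal{L}(u)=\prod_{j=1}^{d}(1-u/\rho_j)$ with real coefficients, all $|\rho_j|=q^{-w/2}$; $d$ is its degree. A zeta function is $\zeta(s)=\prod_{i=0}^{W}L_i(s)^{\epsilon_i}$, $\epsilon_i\in\{1,-1\}$, $L_i$ of weight $i$ and degree $d_i\ge0$ with roots $\rho_{ij}$; its $\Lambda_f$ are defined by $\log\zeta(s)=\sum_{f\ge1}\frac{\Lambda_f}{f}q^{-fs}$. Logarithms are taken factorwise: $\log\zeta(s)=\sum_i\epsilon_i\sum_j\mathrm{Log}(1-q^{-s}/\rho_{ij})$ with $\mathrm{Log}$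 the principal branch (defined when $\Re s\ne i/2$ for all $i$ with $d_i>0$; it agrees with the Dirichlet series where that converges). A family of zeta functions is a sequence $\zeta_k=\prod_{i=0}^{W}L_{ik}^{\epsilon_i}$ with $W,\epsilon_i$ independent of $k$ and $\tilde d_k=\sum_i d_{ik}\to\infty$; it is asymptotically exact if $\delta_i=\lim_k d_{ik}/\tilde d_k$ and $\lambda_f=\lim_k\Lambda_f(\zeta_k)/\tilde d_k$ exist for all $i,f$. Let $I=\{i:\delta_i=0\}$, $w_{\mathbf e}=\max(\{0,\dots,W\}\setminus I)$, $\zeta_{\mathbf e,k}=\prod_{i\notin I}L_{ik}^{\epsilon_i}$ (essential part). The limit zeta function is $\zeta_{\lim}(s)=\exp\big(\sum_{f\ge1}\frac{\lambda_f}{f}q^{-fs}\big)$, with $\log\zeta_{\lim}(s)$ denoting this series (convergent for $\Re s>w_{\mathbf e}/2$). *)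

(* Defs.v *)
(* Stdlib reals with Coquelicot (limits, series, complex numbers). *)
From Stdlib Require Import Reals ZArith Znumtheory List ClassicalEpsilon.
From Coquelicot Require Import Coquelicot.
Import ListNotations.
Open Scope R_scope.

Definition prime_power (q : nat) : Prop :=
  exists p n : nat, prime (Z.of_nat p) /\ (1 <= n)%nat /\ q = (p ^ n)%nat.

(* Complex exponential, principal argument in (-PI, PI], principal logarithm
   (the values at 0 are junk). *)
Definition Cexp (z : C) : C := (exp (Re z) * cos (Im z), exp (Re z) * sin (Im z)).

Definition Carg (z : C) : R :=
  if Rle_dec 0 (Im z) then acos (Re z / Cmod z) else - acos (Re z / Cmod z).

Definition CLog (z : C) : C := (ln (Cmod z), Carg z).

(* q^{-s} *)
Definition qpow (q : nat) (s : C) : C := Cexp (- s * RtoC (ln (INR q)))%C.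

Definition Csum (l : list C) : C := fold_right Cplus (RtoC 0) l.
Definition Cprod (l : list C) : C := fold_right Cmult (RtoC 1) l.

(* The polynomial prod_j (1 - u / rho_j), as a function of u = q^{-s}. *)
Definition Lpoly (rts : list C) (u : C) : C :=
  Cprod (map (fun rho => (1 - u / rho)%C) rts).

(* L-functions of weight w over F_q, given by the roots rho_j of the polynomial
   with multiplicity. *)
Record Lfunction (q w : nat) := mkLfunction {
  Lroots : list C;
  Lroots_mod : forall rho, In rho Lroots ->
    Cmod rho = Rpower (INR q) (- (INR w / 2));
  Lreal_coefs : exists a : nat -> R, forall u : C,
    Lpoly Lroots u = sum_n (fun n => (RtoC (a n) * u ^ n)%C) (length Lroots)
}.
Arguments Lroots {q w} _.

Definition Ldegree {q w : nat} (L : Lfunction q w) : nat := length (Lroots L).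

Definition log_L {q w : nat} (L : Lfunction q w) (s : C) : C :=
  Csum (map (fun rho => CLog (1 - qpow q s / rho)%C) (Lroots L)).

Lemma Lone_mod (q w : nat) : forall rho, In rho (@nil C) ->
  Cmod rho = Rpower (INR q) (- (INR w / 2)).
Proof. intros rho H; destruct H. Qed.

Lemma Lone_real (q w : nat) : exists a : nat -> R, forall u : C,
  Lpoly [] u = sum_n (fun n => (RtoC (a n) * u ^ n)%C) (length (@nil C)).
Proof.
  exists (fun _ => 1); intro u.
  simpl length; rewrite sum_O; unfold Lpoly; simpl; ring.
Qed.

(* The constant L-function 1, of degree 0. *)
Definition Lone (q w : nat) : Lfunction q w :=
  mkLfunction q w [] (Lone_mod q w) (Lone_real q w).

(* prod_{i=0}^{W} L_i(s)^{eps_i}; only the factors with index i <= W are ever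
   used. *)
Record zeta_function (q W : nat) (eps : nat -> R) := mkZeta {
  factor : forall i : nat, Lfunction q i
}.
Arguments factor {q W eps} _ _.

Definition deg {q W eps} (Z : zeta_function q W eps) (i : nat) : nat :=
  Ldegree (factor Z i).

Definition total_degree {q W eps} (Z : zeta_function q W eps) : nat :=
  list_sum (map (deg Z) (seq 0 (S W))).

Definition log_zeta {q W eps} (Z : zeta_function q W eps) (s : C) : C :=
  sum_n (fun i => (RtoC (eps i) * log_L (factor Z i) s)%C) W.

(* The term of index n stands for f = n + 1. *)
Definition dirichlet_term (q : nat) (a : nat -> C) (s : C) (n : nat) : C :=
  (a (S n) / RtoC (INR (S n)) * qpow q (RtoC (INR (S n)) * s))%C.

Definition is_log_coefs {q W eps} (Z : zeta_function q W eps)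
    (a : nat -> C) : Prop :=
  exists sigma : R, forall s : C, sigma < Re s ->
    @is_series C_AbsRing C_NormedModule (dirichlet_term q a s) (log_zeta Z s).

(* Lambda_f for f >= 1, determined uniquely by the Dirichlet series of
   log zeta; the value at f = 0 is meaningless and never used. *)
Definition Lambda {q W eps} (Z : zeta_function q W eps) : nat -> C :=
  epsilon (inhabits (fun _ => RtoC 0)) (is_log_coefs Z).

Record zeta_family (q : nat) := mkFamily {
  fam_W : nat;
  fam_eps : nat -> R;
  fam_eps_pm : forall i, (i <= fam_W)%nat -> fam_eps i = 1 \/ fam_eps i = -1;
  member : nat -> zeta_function q fam_W fam_eps;
  fam_degree :
    is_lim_seq (fun k => INR (total_degree (member k))) p_infty
}.
Arguments fam_W {q} _.
Arguments fam_eps {q} _ _.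
Arguments member {q} _ _.

(* tilde d_k *)
Definition dtot {q} (F : zeta_family q) (k : nat) : R :=
  INR (total_degree (member F k)).

(* The limits delta_i and lambda_f exist and have the given values. *)
Definition asymptotically_exact {q} (F : zeta_family q)
    (delta : nat -> R) (lambda : nat -> C) : Prop :=
  (forall i, (i <= fam_W F)%nat ->
     is_lim_seq (fun k => INR (deg (member F k) i) / dtot F k) (delta i)) /\
  (forall f, (1 <= f)%nat ->
     filterlim (fun k => (Lambda (member F k) f / RtoC (dtot F k))%C)
       eventually (locally (lambda f))).

Definition essential_weight (W : nat) (delta : nat -> R) : nat :=
  list_max
    (filter (fun i => if Req_EM_T (delta i) 0 then false else true)
       (seq 0 (S W))).

(* Dropping the factors with delta_i = 0 amounts to replacing them by 1. *)
Definition essential_part {q W eps} (delta : nat -> R)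
    (Z : zeta_function q W eps) : zeta_function q W eps :=
  mkZeta q W eps
    (fun i => if Req_EM_T (delta i) 0 then Lone q i else factor Z i).

(* Sum of the series log zeta_lim(s), taken componentwise; it is meaningful
   where the series converges. *)
Definition log_zeta_lim (q : nat) (lambda : nat -> C) (s : C) : C :=
  (Series (fun n => Re (dirichlet_term q lambda s n)),
   Series (fun n => Im (dirichlet_term q lambda s n))).

Definition uniform_cv (D : C -> Prop) (f : nat -> C -> C) (g : C -> C) : Prop :=
  forall eta : posreal,
    eventually (fun k => forall s, D s -> Cmod (f k s - g s)%C < eta).

(* Main.v *)
(** For [|z| < 1] the principal logarithm satisfies [Log (1 - z) = - sum z^f / f],
   so [Lambda_f] is minus the signed sum of [rho^{-f}] over the roots, by uniqueness
   of power series coefficients.  A factor of weight [i] contributes at most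
   [d_i q^{i f / 2}] to it.  The inessential factors have total degree
   [o(dtot k)], hence do not affect the limits [lambda_f]; the essential ones give
   coefficients dominated by [q^{we f / 2}] uniformly in [k], and dominated
   convergence of the series yields the first claim, uniformly on
   [Re s >= we / 2 + e].  For the full zeta function one only needs that each
   [Log (1 - q^{-s} / rho)] of an inessential root is bounded, which holds as soon
   as [Re s] stays away from the abscissae [i / 2]. *)

Require Import Defs.
From Stdlib Require Import Reals ZArith Znumtheory List Lra Lia ClassicalEpsilon.
From Coquelicot Require Import Coquelicot.
Import ListNotations.
Open Scope R_scope.

(** * Moduli, limits and series of complex numbers *)

Lemma Rabs_Im_le_Cmod (c : C) : Rabs (Im c) <= Cmod c.
Proof.
  eapply Rle_trans; [apply Rmax_r | apply (Rmax_Cmod c)].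
Qed.

Lemma Cmod_le_re_im (c : C) : Cmod c <= Rabs (Re c) + Rabs (Im c).
Proof.
  replace c with (RtoC (Re c) + Ci * RtoC (Im c))%C at 1.
  - eapply Rle_trans; [apply Cmod_triangle |].
    rewrite Cmod_mult, !Cmod_R.
    replace (Cmod Ci) with 1; [lra |].
    unfold Cmod, Ci; simpl. replace (0 * (0 * 1) + 1 * (1 * 1)) with 1 by ring.
    now rewrite sqrt_1.
  - destruct c as [x y]; unfold RtoC, Ci, Cplus, Cmult; simpl; f_equal; ring.
Qed.

Lemma Cmod_minus_ge (a b : C) : Cmod a - Cmod b <= Cmod (a - b).
Proof.
  assert (H := Cmod_triangle (a - b) b).
  replace (a - b + b)%C with a in H by ring. lra.
Qed.

Lemma Cmod_minus_le (a b : C) : Cmod (a - b) <= Cmod a + Cmod b.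
Proof.
  unfold Cminus. eapply Rle_trans; [apply Cmod_triangle |].
  rewrite Cmod_opp; lra.
Qed.

Lemma Cmod_minus_sym (a b : C) : Cmod (a - b) = Cmod (b - a).
Proof.
  rewrite <- Cmod_opp. f_equal. ring.
Qed.

(** The balls of the uniform structure on [C] are products of real balls; they are comparable with
    discs, at the cost of halving [eps] in one direction. *)
Lemma filterlim_C_iff (f : nat -> C) (l : C) :
  filterlim f eventually (locally l) <->
  forall eps : posreal, eventually (fun k => Cmod (f k - l) < eps).
Proof.
  split.
  - intros H eps.
    assert (He : 0 < eps / 2) by (destruct eps; simpl; lra).
    assert (HH := proj1 (filterlim_locally f l) H (mkposreal _ He)).
    destruct HH as [N HN]; exists N; intros n Hn.
    destruct (HN n Hn) as [H1 H2].
    eapply Rle_lt_trans; [apply Cmod_le_re_im |].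
    change (Rabs (Re (f n) - Re l) < eps / 2) in H1.
    change (Rabs (Im (f n) - Im l) < eps / 2) in H2.
    change (Rabs (Re (f n) - Re l) + Rabs (Im (f n) - Im l) < eps). lra.
  - intros H. apply (proj2 (filterlim_locally f l)). intros eps.
    destruct (H eps) as [N HN]; exists N; intros n Hn.
    specialize (HN n Hn).
    assert (A := re_le_Cmod (f n - l)%C).
    assert (B := Rabs_Im_le_Cmod (f n - l)%C).
    split; eapply Rle_lt_trans; [exact A | exact HN | exact B | exact HN].
Qed.

(** Fixes the structure of [C] as a normed module over itself, so that [is_series] always has the
    reading of the definitions. *)
Definition is_Cseries (c : nat -> C) (l : C) : Prop :=
  @is_series C_AbsRing C_NormedModule c l.

Lemma Re_sum_n (c : nat -> C) (n : nat) : Re (sum_n c n) = sum_n (fun k => Re (c k)) n.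
Proof.
  induction n as [|n IH]; [now rewrite !sum_O |].
  rewrite !sum_Sn, <- IH. reflexivity.
Qed.

Lemma Im_sum_n (c : nat -> C) (n : nat) : Im (sum_n c n) = sum_n (fun k => Im (c k)) n.
Proof.
  induction n as [|n IH]; [now rewrite !sum_O |].
  rewrite !sum_Sn, <- IH. reflexivity.
Qed.

Lemma is_Cseries_iff (c : nat -> C) (l : C) :
  is_Cseries c l <->
  is_series (fun n => Re (c n)) (Re l) /\ is_series (fun n => Im (c n)) (Im l).
Proof.
  unfold is_Cseries, is_series.
  split.
  - intros H. assert (H' := proj1 (filterlim_C_iff (sum_n c) l) H).
    split; apply (is_lim_seq_spec _ (Finite _)); intros eps;
    destruct (H' eps) as [N HN]; exists N; intros n Hn;
    eapply Rle_lt_trans; [| apply (HN n Hn) | | apply (HN n Hn)].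
    + rewrite <- Re_sum_n. apply (re_le_Cmod (sum_n c n - l)%C).
    + rewrite <- Im_sum_n. apply (Rabs_Im_le_Cmod (sum_n c n - l)%C).
  - intros [H1 H2]. apply (proj2 (filterlim_C_iff (sum_n c) l)). intros eps.
    assert (He : 0 < eps / 2) by (destruct eps; simpl; lra).
    destruct (proj2 (is_lim_seq_spec _ (Finite _)) H1 (mkposreal _ He)) as [N1 HN1].
    destruct (proj2 (is_lim_seq_spec _ (Finite _)) H2 (mkposreal _ He)) as [N2 HN2].
    exists (max N1 N2); intros n Hn.
    specialize (HN1 n ltac:(lia)). specialize (HN2 n ltac:(lia)).
    rewrite <- Re_sum_n in HN1. rewrite <- Im_sum_n in HN2. simpl in HN1, HN2.
    eapply Rle_lt_trans; [apply Cmod_le_re_im |].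
    replace (pos eps) with (eps / 2 + eps / 2) by field.
    apply Rplus_lt_compat; [exact HN1 | exact HN2].
Qed.

Lemma is_Cseries_ext (a b : nat -> C) (l : C) :
  (forall n, a n = b n) -> is_Cseries a l -> is_Cseries b l.
Proof. intros H; exact (is_series_ext a b l H). Qed.

Lemma is_Cseries_plus (a b : nat -> C) (la lb : C) :
  is_Cseries a la -> is_Cseries b lb -> is_Cseries (fun n => a n + b n)%C (la + lb)%C.
Proof. intros Ha Hb; exact (is_series_plus a b la lb Ha Hb). Qed.

Lemma is_Cseries_scal (c : C) (a : nat -> C) (l : C) :
  is_Cseries a l -> is_Cseries (fun n => c * a n)%C (c * l)%C.
Proof. intros Ha; exact (is_series_scal c a l Ha). Qed.

Lemma is_Cseries_minus (a b : nat -> C) (la lb : C) :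
  is_Cseries a la -> is_Cseries b lb -> is_Cseries (fun n => a n - b n)%C (la - lb)%C.
Proof.
  intros Ha Hb.
  replace (la - lb)%C with (la + (-1) * lb)%C by ring.
  eapply is_Cseries_ext; [| apply is_Cseries_plus;
    [exact Ha | apply is_Cseries_scal; exact Hb]].
  intros n; simpl; ring.
Qed.

Lemma is_Cseries_zero : is_Cseries (fun _ => RtoC 0) 0.
Proof.
  apply is_Cseries_iff; simpl.
  assert (H : is_series (fun _ : nat => 0) 0).
  { change (is_lim_seq (sum_n (fun _ : nat => 0)) 0).
    apply (is_lim_seq_ext (fun _ => 0)); [| apply is_lim_seq_const].
    intros n; rewrite sum_n_const; ring. }
  split; exact H.
Qed.

Lemma Cmod_sum_n_le (c : nat -> C) (b : nat -> R) (n : nat) :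
  (forall k, (k <= n)%nat -> Cmod (c k) <= b k) -> Cmod (sum_n c n) <= sum_n b n.
Proof.
  induction n as [|n IH]; intros H.
  - rewrite !sum_O; apply H; lia.
  - rewrite !sum_Sn. eapply Rle_trans; [apply (Cmod_triangle (sum_n c n) (c (S n))) |].
    apply Rplus_le_compat; [apply IH; intros; apply H | apply H]; lia.
Qed.

Lemma Cmod_series_le (c : nat -> C) (b : nat -> R) (S : C) (T : R) :
  is_Cseries c S -> is_series b T -> (forall n, Cmod (c n) <= b n) -> Cmod S <= T.
Proof.
  intros Hc Hb H.
  apply (is_lim_seq_le (fun n => Cmod (sum_n c n)) (sum_n b) (Cmod S) T).
  - intros n; now apply Cmod_sum_n_le.
  - apply (is_lim_seq_spec _ (Finite _)). intros eps.
    destruct (proj1 (filterlim_C_iff (sum_n c) S) Hc eps) as [N HN].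
    exists N; intros n Hn. eapply Rle_lt_trans; [| apply (HN n Hn)].
    assert (A := Cmod_minus_ge (sum_n c n) S).
    assert (B := Cmod_minus_ge S (sum_n c n)).
    rewrite Cmod_minus_sym in B. apply Rabs_le; lra.
  - exact Hb.
Qed.

(** * The power series of the principal logarithm *)

Lemma Cpow_geom_series (z : C) :
  Cmod z < 1 -> is_Cseries (fun n => z ^ n)%C (/ (1 - z))%C.
Proof.
  intros Hz.
  assert (Hnz : (1 - z)%C <> 0).
  { apply Cmod_gt_0. assert (A := Cmod_minus_ge 1 z). rewrite Cmod_1 in A. lra. }
  apply (proj2 (filterlim_C_iff (sum_n (fun n => z ^ n)%C) _)). intros eps.
  (* The exact error of the partial sums reduces convergence to that of [Cmod z ^ n]. *)
  assert (Hs : forall n, (sum_n (fun n => z ^ n) n - / (1 - z) = - (z ^ S n) / (1 - z))%C).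
  { induction n as [|n IH].
    - rewrite sum_O. simpl. field. exact Hnz.
    - rewrite sum_Sn. change (plus ?a ?b) with (Cplus a b).
      transitivity (z ^ S n + (sum_n (fun n0 => z ^ n0) n - / (1 - z)))%C; [ring |].
      rewrite IH, (Cpow_S z (S n)). field. exact Hnz. }
  assert (Hl := is_lim_seq_geom (Cmod z)).
  rewrite Rabs_pos_eq in Hl by apply Cmod_ge_0.
  specialize (Hl Hz).
  assert (Hm : 0 < Cmod (1 - z)) by now apply Cmod_gt_0.
  assert (He : 0 < eps * Cmod (1 - z)) by (apply Rmult_lt_0_compat; [apply cond_pos | exact Hm]).
  destruct (proj2 (is_lim_seq_spec _ (Finite _)) Hl (mkposreal _ He)) as [N HN].
  exists N; intros n Hn. rewrite Hs.
  unfold Cdiv. rewrite Cmod_mult, Cmod_opp, Cmod_pow, Cmod_inv by exact Hnz.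
  specialize (HN (S n) ltac:(lia)). simpl in HN.
  rewrite Rminus_0_r in HN.
  rewrite Rabs_pos_eq in HN.
  2:{ apply (pow_le _ (S n)), Cmod_ge_0. }
  apply Rmult_lt_reg_r with (Cmod (1 - z)); [exact Hm |].
  rewrite Rmult_assoc, Rinv_l by lra. simpl. lra.
Qed.

(** On the right half-plane the two branches of [Carg] merge into one arctangent, a formula that can
    be differentiated along a segment. *)
Lemma Carg_atan (w : C) : 0 < Re w -> Carg w = atan (Im w / Re w).
Proof.
  intros Hw.
  assert (Hm : 0 < Cmod w).
  { assert (A := re_le_Cmod w). rewrite Rabs_pos_eq in A; lra. }
  assert (Hm2 := Cmod2_alt w).
  assert (Hq : 0 < Re w / Cmod w) by now apply Rdiv_lt_0_compat.
  assert (H : acos (Re w / Cmod w) = atan (Rabs (Im w) / Re w)).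
  { rewrite acos_atan by exact Hq. f_equal.
    replace (1 - Rsqr (Re w / Cmod w)) with (Rsqr (Im w / Cmod w)).
    - rewrite sqrt_Rsqr_abs. unfold Rdiv.
      rewrite Rabs_mult, (Rabs_pos_eq (/ Cmod w)) by (left; now apply Rinv_0_lt_compat).
      field. lra.
    - unfold Rsqr. apply Rmult_eq_reg_r with (Cmod w ^ 2); [| nra].
      transitivity (Im w ^ 2); [field; lra |].
      transitivity (Cmod w ^ 2 - Re w ^ 2); [rewrite Hm2; ring | field; lra]. }
  unfold Carg. destruct (Rle_dec 0 (Im w)) as [Hi|Hi]; rewrite H.
  - now rewrite Rabs_pos_eq.
  - rewrite Rabs_left by lra. rewrite <- atan_opp. f_equal. field. lra.
Qed.

Lemma ln_Cmod (w : C) : 0 < Cmod w -> ln (Cmod w) = / 2 * ln (Re w ^ 2 + Im w ^ 2).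
Proof.
  intros H. rewrite <- Cmod2_alt. simpl. rewrite Rmult_1_r, ln_mult by exact H. field.
Qed.

Lemma CV_radius_gt_1 (a : nat -> R) (r M : R) :
  0 <= r < 1 -> (forall n, Rabs (a n) <= M * r ^ n) -> Rbar_lt 1 (CV_radius a).
Proof.
  intros Hr Ha.
  (* Any [x] strictly between 1 and [/ r] would do: the coefficients times [x ^ n] stay bounded
     while [x] exceeds 1. This choice also covers [r = 0]. *)
  set (x := 2 / (1 + r)).
  assert (Hx : 1 < x)
    by (unfold x; apply Rmult_lt_reg_r with (1 + r); [lra |]; field_simplify; lra).
  assert (Hrx : r * x < 1)
    by (unfold x; apply Rmult_lt_reg_r with (1 + r); [lra |]; field_simplify; lra).
  apply Rbar_lt_le_trans with x; [exact Hx |].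
  apply (proj1 (CV_radius_bounded a)). exists (Rabs M). intros n.
  rewrite Rabs_mult, (Rabs_pos_eq (x ^ n)) by (apply pow_le; lra).
  apply Rle_trans with (M * r ^ n * x ^ n).
  - apply Rmult_le_compat_r; [apply pow_le; lra | apply Ha].
  - rewrite Rmult_assoc, <- Rpow_mult_distr.
    assert (0 <= (r * x) ^ n <= 1).
    { split; [apply pow_le; nra |]. rewrite <- (pow1 n). apply pow_incr; nra. }
    assert (A := Rle_abs M). assert (B := Rabs_pos M). nra.
Qed.

(** Termwise integration on [0, 1]: [f] and the integrated power series have the same derivative and
    both vanish at 0. The decay of [d] pushes the radius of convergence beyond 1, so the endpoint 1
    is included. *)
Lemma series_of_derivative (f : R -> R) (df : R -> R) (d : nat -> R) (r : R) :
  0 <= r < 1 -> (forall n, Rabs (d n) <= r ^ S n) -> f 0 = 0 ->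
  (forall t, 0 <= t <= 1 -> is_derive f t (df t)) ->
  (forall t, 0 <= t <= 1 -> is_series (fun n => d n * t ^ n) (df t)) ->
  is_series (fun n => d n / INR (S n)) (f 1).
Proof.
  intros Hr Hd Hf0 Hdf Hs.
  set (a := fun n => match n with O => 0 | S m => d m / INR (S m) end).
  assert (Ha : forall n, Rabs (a n) <= 1 * r ^ n).
  { intros [|n]; unfold a.
    - rewrite Rabs_R0; simpl; lra.
    - rewrite Rmult_1_l. eapply Rle_trans; [| apply Hd].
      assert (Hn : 1 <= INR (S n)) by (rewrite S_INR; assert (B := pos_INR n); lra).
      unfold Rdiv. rewrite Rabs_mult, (Rabs_pos_eq (/ INR (S n))).
      + rewrite <- (Rmult_1_r (Rabs (d n))) at 2.
        apply Rmult_le_compat_l; [apply Rabs_pos |].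
        rewrite <- Rinv_1. apply Rinv_le_contravar; lra.
      + left. apply Rinv_0_lt_compat; lra. }
  assert (Hcv := CV_radius_gt_1 a r 1 Hr Ha).
  assert (Hin : forall t, 0 <= t <= 1 -> Rbar_lt (Rabs t) (CV_radius a)).
  { intros t Ht. rewrite Rabs_pos_eq by lra.
    apply Rbar_le_lt_trans with 1; [exact (proj2 Ht) | exact Hcv]. }
  assert (HD : forall t, 0 <= t <= 1 -> PSeries (PS_derive a) t = df t).
  { intros t Ht. unfold PSeries. apply is_series_unique.
    eapply is_series_ext; [| apply Hs, Ht].
    intros n. unfold PS_derive, a. change (d n * t ^ n = INR (S n) * (d n / INR (S n)) * t ^ n).
    field. apply not_0_INR; lia. }
  assert (H1 : f 1 = PSeries a 1).
  { assert (E : f 0 - PSeries a 0 = f 1 - PSeries a 1).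
    { apply (eq_is_derive (fun t => f t - PSeries a t) 0 1); [| lra].
      intros t Ht.
      replace (@zero R_NormedModule) with (df t - PSeries (PS_derive a) t).
      - apply (is_derive_minus f (PSeries a)); [now apply Hdf |].
        apply is_derive_PSeries, Hin, Ht.
      - rewrite HD by exact Ht. unfold zero; simpl. ring. }
    rewrite PSeries_0 in E. unfold a at 1 in E. lra. }
  rewrite H1.
  assert (Hp := PSeries_correct a 1 (CV_radius_inside a 1 (Hin 1 ltac:(lra)))).
  apply is_pseries_R in Hp.
  assert (Hp' : is_series (fun n => a n * 1 ^ n) (plus (PSeries a 1) (a O * 1 ^ 0))).
  { replace (plus (PSeries a 1) (a O * 1 ^ 0)) with (PSeries a 1); [exact Hp |].
    change (PSeries a 1 = PSeries a 1 + 0 * 1). ring. }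
  apply (is_series_incr_1 (fun n => a n * 1 ^ n)) in Hp'.
  eapply is_series_ext; [| exact Hp'].
  intros n. unfold a. rewrite pow1. apply Rmult_1_r.
Qed.

(** For [t] in [0, 1] the point [1 - t z] keeps a positive real part, so the principal branch is
    smooth along this segment. Its derivative [- z / (1 - t z)] is a geometric series, which is
    integrated separately in real and imaginary parts. *)
Lemma CLog_series (z : C) :
  Cmod z < 1 ->
  is_Cseries (fun n => - z ^ S n / RtoC (INR (S n)))%C (CLog (1 - z)).
Proof.
  intros Hz.
  set (x := Re z). set (y := Im z).
  assert (Hz2 := Cmod2_alt z). fold x y in Hz2.
  assert (Hz0 := Cmod_ge_0 z).
  assert (Hx : Rabs x <= Cmod z) by apply re_le_Cmod.
  assert (Hpos : forall t, 0 <= t <= 1 -> 0 < 1 - t * x).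
  { intros t Ht. assert (B := Rle_abs x). nra. }
  assert (Hw : forall t : R, (1 - RtoC t * z)%C = (1 - t * x, - (t * y))).
  { intros t. rewrite (surjective_pairing z) at 1. fold (Re z) (Im z). fold x y.
    unfold RtoC, Cminus, Cplus, Cmult, Copp; simpl. f_equal; ring. }
  (* The derivative in [t] of [Log (1 - t z)], with numerator and denominator in coordinates to
     match the real derivatives computed below. *)
  assert (Hgeo : forall t : R, 0 <= t <= 1 ->
    is_Cseries (fun n => - z ^ S n * RtoC t ^ n)%C
      (- (x, y) / ((1 - t * x)%R, (- (t * y))%R))%C).
  { intros t Ht. rewrite <- Hw.
    change (- (x, y))%C with (- (Re z, Im z))%C.
    replace (Re z, Im z) with z by (destruct z; reflexivity).
    eapply is_Cseries_ext; [| apply is_Cseries_scal, (Cpow_geom_series (RtoC t * z)%C)].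
    - intros n; simpl. rewrite Cpow_mult_l. ring.
    - rewrite Cmod_mult, Cmod_R, Rabs_pos_eq by lra. nra. }
  assert (Hscal : forall (c : C) (t : R) n, Re (c * RtoC t ^ n)%C = Re c * t ^ n /\
     Im (c * RtoC t ^ n)%C = Im c * t ^ n).
  { intros c t n. rewrite <- RtoC_pow. now rewrite re_scal_r, im_scal_r. }
  assert (Hb : forall n, Cmod (- z ^ S n)%C = Cmod z ^ S n).
  { intros n. now rewrite Cmod_opp, Cmod_pow. }
  assert (Hdiv : forall (c : C) n, Re (c / RtoC (INR (S n)))%C = Re c / INR (S n) /\
     Im (c / RtoC (INR (S n)))%C = Im c / INR (S n)).
  { intros c n. unfold Cdiv. rewrite <- RtoC_inv by (apply not_0_INR; lia).
    now rewrite re_scal_r, im_scal_r. }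
  assert (Hval : CLog (1 - z)%C =
    (/ 2 * ln ((1 - 1 * x) ^ 2 + (1 * y) ^ 2), atan (- (1 * y) / (1 - 1 * x)))).
  { specialize (Hw 1). rewrite Cmult_1_l in Hw.
    unfold CLog. rewrite Carg_atan, ln_Cmod.
    - rewrite Hw; unfold Re, Im; simpl. f_equal. do 2 f_equal. ring.
    - apply Cmod_gt_0. rewrite Hw. intros E. injection E. intros. specialize (Hpos 1). lra.
    - rewrite Hw. apply (Hpos 1); lra. }
  rewrite Hval. apply is_Cseries_iff. unfold Re at 2, Im at 2; simpl fst; simpl snd.
  split.
  - eapply is_series_ext.
    { intros n. symmetry. apply Hdiv. }
    apply (series_of_derivative (fun t => / 2 * ln ((1 - t * x) ^ 2 + (t * y) ^ 2))
      (fun t => Re (- (x, y) / ((1 - t * x)%R, (- (t * y))%R))%C) (fun n => Re (- z ^ S n)%C) (Cmod z)).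
    + lra.
    + intros n. rewrite <- Hb. apply re_le_Cmod.
    + replace ((1 - 0 * x) ^ 2 + (0 * y) ^ 2) with 1 by ring. rewrite ln_1; ring.
    + intros t Ht. specialize (Hpos t Ht).
      assert (0 < (1 - t * x) ^ 2 + (t * y) ^ 2) by nra.
      auto_derive; [simpl in *; lra |].
      unfold Cdiv, Cinv, Cmult, Copp, Re; simpl. field. simpl in *; lra.
    + intros t Ht. eapply is_series_ext; [| apply (proj1 (is_Cseries_iff _ _) (Hgeo t Ht))].
      intros n. apply Hscal.
  - eapply is_series_ext.
    { intros n. symmetry. apply Hdiv. }
    apply (series_of_derivative (fun t => atan (- (t * y) / (1 - t * x)))
      (fun t => Im (- (x, y) / ((1 - t * x)%R, (- (t * y))%R))%C) (fun n => Im (- z ^ S n)%C) (Cmod z)).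
    + lra.
    + intros n. rewrite <- Hb. apply Rabs_Im_le_Cmod.
    + replace (- (0 * y) / (1 - 0 * x)) with 0 by field. apply atan_0.
    + intros t Ht. specialize (Hpos t Ht).
      assert (0 < (1 - t * x) ^ 2 + (t * y) ^ 2) by nra.
      auto_derive; [lra |].
      unfold Cdiv, Cinv, Cmult, Copp, Im; simpl. field. simpl in *; repeat split; nra.
    + intros t Ht. eapply is_series_ext; [| apply (proj1 (is_Cseries_iff _ _) (Hgeo t Ht))].
      intros n. apply Hscal.
Qed.

(** * Uniqueness of power series coefficients *)

(** The point 0 is left out because the values [q^{-s}] to which this is applied never vanish.
    Nothing is lost: the series have no constant term, so both sums are 0 there. *)
Lemma real_coefs_unique (a b : nat -> R) (r : R) :
  0 < r ->
  (forall x : R, x <> 0 -> Rabs x < r -> exists S : R,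
     is_series (fun n => a n * x ^ Datatypes.S n) S /\
     is_series (fun n => b n * x ^ Datatypes.S n) S) ->
  forall n, a n = b n.
Proof.
  intros Hr H n.
  set (shift := fun (c : nat -> R) m => match m with O => 0 | S p => c p end).
  assert (Hshift : forall c (x S : R), is_series (fun n => c n * x ^ Datatypes.S n) S ->
    is_pseries (shift c) x S).
  { intros c x S Hs. apply is_pseries_R. apply is_series_decr_1.
    match goal with |- is_series _ ?l => replace l with S; [exact Hs |] end.
    change (S = S + - (0 * 1)). ring. }
  assert (Hcv : forall c, (forall x, x <> 0 -> Rabs x < r ->
      exists S, is_series (fun n => c n * x ^ Datatypes.S n) S) ->
    Rbar_lt 0 (CV_radius (shift c))).
  { intros c Hc. apply Rbar_not_le_lt. intros Hle.
    assert (Hr2 : Rabs (r / 2) = r / 2) by (apply Rabs_pos_eq; lra).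
    destruct (Hc (r / 2)) as [S HS]; [lra | lra |].
    apply (CV_disk_outside (shift c) (r / 2)).
    - apply Rbar_le_lt_trans with 0; [exact Hle | rewrite Hr2; simpl; lra].
    - apply (ex_series_lim_0 (fun n => shift c n * (r / 2) ^ n)).
      exists S. apply is_pseries_R, Hshift, HS. }
  change (shift a (S n) = shift b (S n)).
  apply PSeries_ext_recip.
  - apply Hcv. intros x Hx Hxr. destruct (H x Hx Hxr) as [S [HS _]]. now exists S.
  - apply Hcv. intros x Hx Hxr. destruct (H x Hx Hxr) as [S [_ HS]]. now exists S.
  - exists (mkposreal r Hr). intros x Hx.
    change (Rabs (x - 0) < r) in Hx. rewrite Rminus_0_r in Hx.
    destruct (Req_dec x 0) as [-> | Hx0].
    + now rewrite !PSeries_0.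
    + destruct (H x Hx0 Hx) as [S [Ha Hb]].
      rewrite (is_pseries_unique _ _ _ (Hshift a x S Ha)).
      now rewrite (is_pseries_unique _ _ _ (Hshift b x S Hb)).
Qed.

(** Real arguments suffice: powers of a real [x] commute with taking real and imaginary parts, which
    separates the problem into two real ones. *)
Lemma complex_coefs_unique (a b : nat -> C) (r : R) :
  0 < r ->
  (forall x : R, x <> 0 -> Rabs x < r -> exists S : C,
     is_Cseries (fun n => a n * RtoC x ^ Datatypes.S n)%C S /\
     is_Cseries (fun n => b n * RtoC x ^ Datatypes.S n)%C S) ->
  forall n, a n = b n.
Proof.
  intros Hr H n.
  assert (Hre : forall (c : C) (x : R) m, Re (c * RtoC x ^ m)%C = Re c * x ^ m).
  { intros c x m. rewrite <- RtoC_pow. apply re_scal_r. }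
  assert (Him : forall (c : C) (x : R) m, Im (c * RtoC x ^ m)%C = Im c * x ^ m).
  { intros c x m. rewrite <- RtoC_pow. apply im_scal_r. }
  assert (E1 : Re (a n) = Re (b n)).
  { revert n. apply (real_coefs_unique (fun n => Re (a n)) (fun n => Re (b n)) r Hr).
    intros x Hx Hxr. destruct (H x Hx Hxr) as [S [Ha Hb]]. exists (Re S).
    apply is_Cseries_iff, proj1 in Ha. apply is_Cseries_iff, proj1 in Hb.
    split; eapply is_series_ext; [| exact Ha | | exact Hb]; intros m; apply Hre. }
  assert (E2 : Im (a n) = Im (b n)).
  { clear E1; revert n.
    apply (real_coefs_unique (fun n => Im (a n)) (fun n => Im (b n)) r Hr).
    intros x Hx Hxr. destruct (H x Hx Hxr) as [S [Ha Hb]]. exists (Im S).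
    apply is_Cseries_iff, proj2 in Ha. apply is_Cseries_iff, proj2 in Hb.
    split; eapply is_series_ext; [| exact Ha | | exact Hb]; intros m; apply Him. }
  destruct (a n), (b n); unfold Re, Im in *; simpl in *; congruence.
Qed.

(** * The function [q^{-s}] *)

Lemma prime_power_ge_2 (q : nat) : prime_power q -> 2 <= INR q.
Proof.
  intros (p & n & Hp & Hn & ->).
  apply prime_ge_2 in Hp.
  apply (le_INR 2).
  destruct n as [|n]; [lia |]. simpl.
  assert (0 < p ^ n)%nat by (apply Nat.neq_0_lt_0, Nat.pow_nonzero; lia). nia.
Qed.

Lemma Cexp_pow (z : C) (n : nat) : Cexp (RtoC (INR n) * z)%C = (Cexp z ^ n)%C.
Proof.
  assert (Hadd : forall a b, Cexp (a + b)%C = (Cexp a * Cexp b)%C).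
  { intros [a1 a2] [b1 b2]. unfold Cexp, Cplus, Cmult, Re, Im; simpl.
    rewrite exp_plus, cos_plus, sin_plus. f_equal; ring. }
  induction n as [|n IH].
  - simpl. rewrite Cmult_0_l. unfold Cexp; simpl. rewrite exp_0, cos_0, sin_0.
    unfold RtoC; f_equal; ring.
  - rewrite S_INR, RtoC_plus, Cpow_S, <- IH, <- Hadd. f_equal. ring.
Qed.

Lemma Cmod_Cexp (z : C) : Cmod (Cexp z) = exp (Re z).
Proof.
  unfold Cexp, Cmod; simpl.
  assert (Hp := exp_pos (Re z)).
  assert (H := sin2_cos2 (Im z)). unfold Rsqr in H.
  replace (_ + _) with (Rsqr (exp (Re z))); [apply sqrt_Rsqr; lra |].
  unfold Rsqr.
  transitivity (exp (Re z) * exp (Re z) *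
    (sin (Im z) * sin (Im z) + cos (Im z) * cos (Im z))); [rewrite H; ring | ring].
Qed.

(** Turns Dirichlet series in [s] into power series in [u = q^{-s}]. *)
Lemma qpow_mult (q n : nat) (s : C) : qpow q (RtoC (INR n) * s) = (qpow q s ^ n)%C.
Proof.
  unfold qpow. rewrite <- Cexp_pow. f_equal. ring.
Qed.

Lemma Cmod_qpow (q : nat) (s : C) : Cmod (qpow q s) = Rpower (INR q) (- Re s).
Proof.
  unfold qpow. rewrite Cmod_Cexp, re_scal_r. reflexivity.
Qed.

(* Negative values are reached with [Im s = PI / ln q]. *)
Lemma qpow_real_surjective (q : nat) (sigma x : R) :
  2 <= INR q -> x <> 0 -> Rabs x < Rpower (INR q) (- sigma) ->
  exists s : C, sigma < Re s /\ qpow q s = RtoC x.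
Proof.
  intros Hq Hx Hxs.
  assert (Hl : 0 < ln (INR q)) by (rewrite <- ln_1; apply ln_increasing; lra).
  assert (Ha : 0 < Rabs x) by now apply Rabs_pos_lt.
  set (L := ln (INR q)) in *.
  exists (- ln (Rabs x) / L, if Rle_dec 0 x then 0 else PI / L). split.
  - apply ln_increasing in Hxs; [| exact Ha].
    unfold Rpower in Hxs. rewrite ln_exp in Hxs. fold L in Hxs.
    unfold Re; simpl. apply Rmult_lt_reg_r with L; [exact Hl |].
    replace (- ln (Rabs x) / L * L) with (- ln (Rabs x)) by (field; lra). lra.
  - unfold qpow, Cexp. fold L. rewrite re_scal_r, im_scal_r. unfold Re, Im; simpl.
    replace (- (- ln (Rabs x) / L) * L) with (ln (Rabs x)) by (field; lra).
    rewrite exp_ln by exact Ha. unfold RtoC.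
    destruct (Rle_dec 0 x).
    + replace (- 0 * L) with 0 by ring. rewrite cos_0, sin_0, Rabs_pos_eq by lra.
      f_equal; ring.
    + replace (- (PI / L) * L) with (- PI) by (field; lra).
      rewrite cos_neg, sin_neg, cos_PI, sin_PI, Rabs_left by lra. f_equal; ring.
Qed.

(** * Signed sums over the roots of a zeta function *)

Lemma Cmod_Csum_le (phi : C -> C) (l : list C) (M : R) :
  (forall rho, In rho l -> Cmod (phi rho) <= M) ->
  Cmod (Csum (map phi l)) <= M * INR (length l).
Proof.
  induction l as [|rho l IH]; intros H.
  - simpl. rewrite Cmod_0. lra.
  - change (Cmod (phi rho + Csum (map phi l))%C <= M * INR (S (length l))).
    rewrite S_INR. eapply Rle_trans; [apply Cmod_triangle |].
    assert (A := H rho (or_introl eq_refl)).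
    assert (B := IH (fun r Hr => H r (or_intror Hr))). lra.
Qed.

Lemma Csum_series (phi : nat -> C -> C) (psi : C -> C) (l : list C) :
  (forall rho, In rho l -> is_Cseries (fun n => phi n rho) (psi rho)) ->
  is_Cseries (fun n => Csum (map (phi n) l)) (Csum (map psi l)).
Proof.
  induction l as [|rho l IH]; intros H.
  - exact is_Cseries_zero.
  - apply (is_Cseries_plus (fun n => phi n rho) (fun n => Csum (map (phi n) l))).
    + apply H; now left.
    + apply IH. intros r Hr; apply H; now right.
Qed.

Lemma Csum_scal (c : C) (phi : C -> C) (l : list C) :
  (c * Csum (map phi l) = Csum (map (fun rho => c * phi rho) l))%C.
Proof.
  induction l as [|rho l IH]; simpl; [ring |].
  change (c * (phi rho + Csum (map phi l)) =
    c * phi rho + Csum (map (fun r => c * phi r) l))%C.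
  rewrite <- IH. ring.
Qed.

Lemma sum_n_series (c : nat -> nat -> C) (l : nat -> C) (W : nat) :
  (forall i, (i <= W)%nat -> is_Cseries (fun n => c n i) (l i)) ->
  is_Cseries (fun n => sum_n (c n) W) (sum_n l W).
Proof.
  induction W as [|W IH]; intros H.
  - eapply is_Cseries_ext; [| rewrite sum_O; apply H; lia].
    intros n; now rewrite sum_O.
  - rewrite sum_Sn.
    eapply is_Cseries_ext;
      [| apply (is_Cseries_plus (fun n => sum_n (c n) W) (fun n => c n (S W)))].
    + intros n. now rewrite sum_Sn.
    + apply IH. intros; apply H; lia.
    + apply H; lia.
Qed.

(* Both [log_zeta Z s] and the Dirichlet coefficients have this form, so that one
   estimate of each kind serves for both. *)
Definition root_sum {q W eps} (Z : zeta_function q W eps) (phi : nat -> C -> C) : C :=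
  sum_n (fun i => (RtoC (eps i) * Csum (map (phi i) (Lroots (factor Z i))))%C) W.

Lemma root_sum_scal {q W eps} (Z : zeta_function q W eps) (c : C) phi :
  (c * root_sum Z phi = root_sum Z (fun i rho => c * phi i rho))%C.
Proof.
  unfold root_sum. rewrite <- (sum_n_mult_l (K := C_Ring) c). apply sum_n_ext. intros i.
  change (c * (RtoC (eps i) * Csum (map (phi i) (Lroots (factor Z i)))) =
    RtoC (eps i) * Csum (map (fun rho => c * phi i rho) (Lroots (factor Z i))))%C.
  rewrite <- Csum_scal. ring.
Qed.

Lemma root_sum_ext {q W eps} (Z : zeta_function q W eps) phi psi :
  (forall i rho, phi i rho = psi i rho) -> root_sum Z phi = root_sum Z psi.
Proof.
  intros H. apply sum_n_ext. intros i. do 2 f_equal. apply map_ext, H.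
Qed.

Lemma root_sum_series {q W eps} (Z : zeta_function q W eps)
    (phi : nat -> nat -> C -> C) (psi : nat -> C -> C) :
  (forall i rho, (i <= W)%nat -> In rho (Lroots (factor Z i)) ->
     is_Cseries (fun n => phi n i rho) (psi i rho)) ->
  is_Cseries (fun n => root_sum Z (phi n)) (root_sum Z psi).
Proof.
  intros H. apply sum_n_series. intros i Hi.
  apply is_Cseries_scal, (Csum_series (fun n => phi n i)). intros rho; apply H, Hi.
Qed.

Lemma INR_total_degree {q W eps} (Z : zeta_function q W eps) :
  INR (total_degree Z) = sum_n (fun i => INR (deg Z i)) W.
Proof.
  unfold total_degree. generalize (deg Z). clear Z. intros d. induction W as [|n IH].
  - rewrite sum_O. simpl. now rewrite Nat.add_0_r.
  - rewrite sum_Sn, seq_S, map_app, list_sum_app, plus_INR, IH.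
    simpl. now rewrite Nat.add_0_r.
Qed.

Lemma root_sum_le {q W eps} (Z : zeta_function q W eps) phi (M : R) :
  (forall i, (i <= W)%nat -> eps i = 1 \/ eps i = -1) ->
  (forall i rho, (i <= W)%nat -> In rho (Lroots (factor Z i)) -> Cmod (phi i rho) <= M) ->
  Cmod (root_sum Z phi) <= M * INR (total_degree Z).
Proof.
  intros He H. rewrite INR_total_degree, <- (sum_n_mult_l (K := R_Ring) M).
  apply Cmod_sum_n_le. intros i Hi.
  rewrite Cmod_mult, Cmod_R.
  replace (Rabs (eps i)) with 1.
  - rewrite Rmult_1_l. apply Cmod_Csum_le. intros rho; apply H, Hi.
  - destruct (He i Hi) as [-> | ->]; [now rewrite Rabs_R1 |].
    rewrite Rabs_left; lra.
Qed.

(** * Splitting into essential and inessential factors *)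

Definition inessential_part {q W eps} (delta : nat -> R)
    (Z : zeta_function q W eps) : zeta_function q W eps :=
  mkZeta q W eps
    (fun i => if Req_EM_T (delta i) 0 then factor Z i else Lone q i).

Lemma root_sum_split {q W eps} (delta : nat -> R) (Z : zeta_function q W eps) phi :
  root_sum Z phi =
    (root_sum (essential_part delta Z) phi + root_sum (inessential_part delta Z) phi)%C.
Proof.
  unfold root_sum. rewrite <- (sum_n_plus (G := C_AbelianMonoid)). apply sum_n_ext.
  intros i. change (plus ?a ?b) with (Cplus a b). simpl.
  destruct (Req_EM_T (delta i) 0); simpl; ring.
Qed.

Lemma In_essential_roots {q W eps} (delta : nat -> R) (Z : zeta_function q W eps) i rho :
  In rho (Lroots (factor (essential_part delta Z) i)) ->
  delta i <> 0 /\ Cmod rho = Rpower (INR q) (- (INR i / 2)).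
Proof.
  simpl. destruct (Req_EM_T (delta i) 0); simpl; [tauto |].
  intros H; split; [assumption | exact (Lroots_mod _ _ _ rho H)].
Qed.

Lemma In_inessential_roots {q W eps} (delta : nat -> R) (Z : zeta_function q W eps) i rho :
  In rho (Lroots (factor (inessential_part delta Z) i)) ->
  delta i = 0 /\ Cmod rho = Rpower (INR q) (- (INR i / 2)).
Proof.
  simpl. destruct (Req_EM_T (delta i) 0); simpl; [| tauto].
  intros H; split; [assumption | exact (Lroots_mod _ _ _ rho H)].
Qed.

Lemma essential_degree_le {q W eps} (delta : nat -> R) (Z : zeta_function q W eps) :
  INR (total_degree (essential_part delta Z)) <= INR (total_degree Z).
Proof.
  rewrite !INR_total_degree. unfold sum_n. apply sum_n_m_le. intros i.
  unfold deg; simpl. destruct (Req_EM_T (delta i) 0); [apply pos_INR | apply Rle_refl].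
Qed.

Lemma essential_weight_ge (W : nat) (delta : nat -> R) (i : nat) :
  (i <= W)%nat -> delta i <> 0 -> (i <= essential_weight W delta)%nat.
Proof.
  intros Hi Hd. unfold essential_weight.
  set (l := filter _ _).
  assert (H : In i l).
  { apply filter_In. split; [apply in_seq; lia |].
    now destruct (Req_EM_T (delta i) 0). }
  assert (A := proj1 (list_max_le l (list_max l)) (Nat.le_refl _)).
  rewrite Forall_forall in A. now apply A.
Qed.

(** * The Dirichlet coefficients in terms of the roots *)

(** The explicit candidate for [Lambda_f], read off the logarithmic series of each factor. *)
Definition root_coefs {q W eps} (Z : zeta_function q W eps) (f : nat) : C :=
  root_sum Z (fun _ rho => - (/ rho) ^ f)%C.

(** The condition bears on the roots actually present rather than on [Re s]. It therefore applies to
    an essential part in its larger half-plane, where the removed factors impose nothing. *)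
Lemma log_zeta_series {q W eps} (Z : zeta_function q W eps) (s : C) :
  (forall i rho, (i <= W)%nat -> In rho (Lroots (factor Z i)) ->
     Cmod (qpow q s / rho) < 1) ->
  is_Cseries (dirichlet_term q (root_coefs Z) s) (log_zeta Z s).
Proof.
  intros H.
  eapply is_Cseries_ext.
  2:{ apply (root_sum_series Z
        (fun n _ rho => - (qpow q s / rho) ^ S n / RtoC (INR (S n)))%C
        (fun i rho => CLog (1 - qpow q s / rho))).
      intros i rho Hi Hr. apply CLog_series. now apply (H i). }
  intros n. unfold dirichlet_term, root_coefs.
  rewrite qpow_mult.
  transitivity (qpow q s ^ S n / RtoC (INR (S n)) *
    root_sum Z (fun _ rho => - (/ rho) ^ S n))%C.
  - rewrite root_sum_scal. apply root_sum_ext. intros _ rho. unfold Cdiv.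
    rewrite Cpow_mult_l. ring.
  - unfold Cdiv. ring.
Qed.

Lemma Rpower_lt_1 (x y : R) : 1 < x -> y < 0 -> Rpower x y < 1.
Proof.
  intros Hx Hy. rewrite <- (Rpower_O x) by lra. now apply Rpower_lt.
Qed.

(** The exponent is the signed distance from [Re s] to the abscissa [i / 2]: its sign decides
    convergence of the logarithmic series, its size keeps [1 - q^{-s} / rho] away from 0. *)
Lemma Cmod_qpow_div (q i : nat) (s rho : C) :
  2 <= INR q -> Cmod rho = Rpower (INR q) (- (INR i / 2)) ->
  Cmod (qpow q s / rho) = Rpower (INR q) (INR i / 2 - Re s).
Proof.
  intros Hq Hr.
  assert (Hp : 0 < Cmod rho) by (rewrite Hr; apply exp_pos).
  unfold Cdiv. rewrite Cmod_mult, Cmod_inv by now apply Cmod_gt_0.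
  rewrite Cmod_qpow, Hr, <- Rpower_Ropp, <- Rpower_plus. f_equal. ring.
Qed.

(** [Lambda] is chosen by [epsilon], so it satisfies its specification once [root_coefs] is known to
    satisfy it. The two expansions then agree for all small nonzero real values of [q^{-s}], and
    uniqueness of coefficients applies. *)
Lemma Lambda_roots {q W eps} (Z : zeta_function q W eps) (n : nat) :
  2 <= INR q -> Lambda Z (S n) = root_coefs Z (S n).
Proof.
  intros Hq.
  assert (Hroots : is_log_coefs Z (root_coefs Z)).
  { exists (INR W / 2). intros s Hs. apply log_zeta_series.
    intros i rho Hi Hr. rewrite (Cmod_qpow_div q i s rho Hq (Lroots_mod _ _ _ rho Hr)).
    apply le_INR in Hi. apply Rpower_lt_1; lra. }
  assert (HL : is_log_coefs Z (Lambda Z)).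
  { unfold Lambda. apply epsilon_spec. now exists (root_coefs Z). }
  destruct Hroots as [s1 H1]. destruct HL as [s2 H2].
  assert (Hsc : (RtoC (INR (S n)) <> 0)%C).
  { intros E. apply RtoC_inj in E. revert E. apply not_0_INR; lia. }
  assert (E : (Lambda Z (S n) / RtoC (INR (S n)) = root_coefs Z (S n) / RtoC (INR (S n)))%C).
  { apply (complex_coefs_unique (fun n => Lambda Z (S n) / RtoC (INR (S n)))%C
      (fun n => root_coefs Z (S n) / RtoC (INR (S n)))%C
      (* Below this radius every nonzero real number is some [q^{-s}] with [s] in both half-planes
         of convergence. *)
      (Rpower (INR q) (- Rmax s1 s2))); [apply exp_pos |].
    intros x Hx Hxr.
    destruct (qpow_real_surjective q _ x Hq Hx Hxr) as [s [Hs Es]].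
    assert (A := Rmax_l s1 s2). assert (B := Rmax_r s1 s2).
    exists (log_zeta Z s).
    split; eapply is_Cseries_ext; [| apply H2; lra | | apply H1; lra]; intros m;
      unfold dirichlet_term; rewrite qpow_mult, Es; reflexivity. }
  transitivity (Lambda Z (S n) / RtoC (INR (S n)) * RtoC (INR (S n)))%C; [now field |].
  rewrite E. now field.
Qed.

(** * Dominated convergence, uniformly in the variable *)

Lemma eventually_forall_lt (P : nat -> nat -> Prop) (N : nat) :
  (forall n, eventually (P n)) -> eventually (fun k => forall n, (n < N)%nat -> P n k).
Proof.
  intros H. induction N as [|N IH].
  - exists O; intros; lia.
  - destruct IH as [K1 H1]. destruct (H N) as [K2 H2].
    exists (max K1 K2). intros k Hk n Hn.
    destruct (Nat.eq_dec n N) as [-> | Hne]; [apply H2 | apply H1]; lia.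
Qed.

(* Of the decay [rho ^ (2 n)] of the terms, one factor [rho ^ n] makes the tail small
   and the other keeps the majorant a full geometric series. *)
Lemma uniform_tannery (b : nat -> nat -> C) (l : nat -> C) (B rho : R) :
  0 < B -> 0 < rho < 1 ->
  eventually (fun k => forall n, Cmod (b k n) <= B ^ S n) ->
  (forall n, Cmod (l n) <= B ^ S n) ->
  (forall n (eps : posreal), eventually (fun k => Cmod (b k n - l n) < eps)) ->
  forall eta : posreal, eventually (fun k => forall u sb sl : C,
    Cmod u <= rho ^ 2 / B ->
    is_Cseries (fun n => b k n * u ^ S n)%C sb ->
    is_Cseries (fun n => l n * u ^ S n)%C sl -> Cmod (sb - sl) < eta).
Proof.
  intros HB Hrho [K1 HK1] Hl Hlim eta.
  assert (Heta := cond_pos eta).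
  (* Chosen so that the final majorant [2 d rho / (1 - rho)] equals [eta * rho], which is below
     [eta]. *)
  set (d := eta * (1 - rho) / 2).
  assert (Hd : 0 < d) by (unfold d; nra).
  assert (Hd2 : 0 < d / 2) by lra.
  destruct (proj2 (is_lim_seq_spec _ (Finite _))
    (is_lim_seq_geom rho ltac:(rewrite Rabs_pos_eq; lra)) (mkposreal _ Hd2)) as [N HN].
  specialize (HN N (Nat.le_refl N)). simpl in HN.
  assert (HrN : 0 < rho ^ N) by (apply pow_lt; lra).
  rewrite Rminus_0_r, Rabs_pos_eq in HN by lra.
  assert (Hev : eventually (fun k => forall n, (n < N)%nat ->
    Cmod (b k n - l n) < d * B ^ S n)).
  { apply eventually_forall_lt. intros n.
    assert (Hp : 0 < d * B ^ S n) by (apply Rmult_lt_0_compat; [exact Hd | now apply pow_lt]).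
    exact (Hlim n (mkposreal _ Hp)). }
  destruct Hev as [K2 HK2].
  exists (max K1 K2). intros k Hk u sb sl Hu Hsb Hsl.
  assert (Hg : is_series (fun n => (2 * d * rho) * rho ^ n) ((2 * d * rho) * / (1 - rho))).
  { apply (is_series_scal (V := R_NormedModule) (2 * d * rho)), is_series_geom.
    rewrite Rabs_pos_eq; lra. }
  apply Rle_lt_trans with ((2 * d * rho) * / (1 - rho)).
  2:{ unfold d. replace (_ * / _) with (eta * rho) by (field; lra). nra. }
  apply (Cmod_series_le _ _ _ _ (is_Cseries_minus _ _ _ _ Hsb Hsl) Hg).
  intros n. simpl.
  replace (b k n * (u * u ^ n) - l n * (u * u ^ n))%C with ((b k n - l n) * u ^ S n)%C
    by (simpl; ring).
  rewrite Cmod_mult, Cmod_pow.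
  assert (Hpos : 0 < rho ^ S n) by (apply pow_lt; lra).
  assert (HBu : B ^ S n * Cmod u ^ S n <= rho ^ S n * rho ^ S n).
  { rewrite <- !Rpow_mult_distr. apply pow_incr.
    assert (A := Cmod_ge_0 u). split; [nra |].
    apply Rmult_le_compat_l with (r := B) in Hu; [| lra].
    replace (B * (rho ^ 2 / B)) with (rho * rho) in Hu by (field; lra). exact Hu. }
  assert (Hu0 : 0 <= Cmod u ^ S n) by apply pow_le, Cmod_ge_0.
  replace (2 * d * rho * rho ^ n) with (2 * d * rho ^ S n) by (simpl; ring).
  (* In the head, termwise convergence gives the factor [d]. In the tail, only the bound
     [2 * B ^ S n] is available and the small factor comes from [rho ^ N < d / 2]. *)
  destruct (Nat.lt_ge_cases n N) as [Hn | Hn].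
  - assert (A := HK2 k ltac:(lia) n Hn).
    assert (E : rho ^ S n <= 1).
    { rewrite <- (pow1 (S n)). apply pow_incr; lra. }
    apply Rle_trans with (d * B ^ S n * Cmod u ^ S n).
    + apply Rmult_le_compat_r; lra.
    + rewrite Rmult_assoc. apply Rle_trans with (d * (rho ^ S n * rho ^ S n)).
      2:{ revert Hpos E. generalize (rho ^ S n). intros p Hp0 Hp1.
          assert (p * p <= p) by nra. assert (0 < d * p) by nra. nra. }
      apply Rmult_le_compat_l; lra.
  - assert (E : rho ^ S n <= rho ^ N).
    { replace (S n) with (N + (S n - N))%nat by lia. rewrite pow_add.
      assert (rho ^ (S n - N) <= 1) by (rewrite <- (pow1 (S n - N)); apply pow_incr; lra).
      nra. }
    assert (A : Cmod (b k n - l n) <= 2 * B ^ S n).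
    { eapply Rle_trans; [apply Cmod_minus_le |].
      assert (A1 := HK1 k ltac:(lia) n). assert (A2 := Hl n). lra. }
    apply Rle_trans with (2 * B ^ S n * Cmod u ^ S n).
    + apply Rmult_le_compat_r; lra.
    + rewrite Rmult_assoc. apply Rle_trans with (2 * (rho ^ S n * rho ^ S n)); [lra |].
      rewrite <- Rmult_assoc. apply Rmult_le_compat_r; lra.
Qed.

(** * Bounding the principal logarithm away from its singularity *)

(** The argument is at most [PI] in absolute value, so only [ln (Cmod (1 - z))] needs care. Keeping
    [Cmod z] away from 1 on either side bounds [Cmod (1 - z)] below, and [Y] bounds it above. *)
Lemma CLog_bound (q Y e : R) :
  1 < q -> 0 < e -> exists M, forall (z : C) (y : R),
    Cmod z = Rpower q y -> y <= Y -> e <= Rabs y -> Cmod (CLog (1 - z)) <= M.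
Proof.
  intros Hq He.
  set (m := 1 - Rpower q (- e)). set (M := 1 + Rpower q Y).
  assert (Hm : 0 < m) by (assert (A := Rpower_lt_1 q (- e) Hq); unfold m; lra).
  exists (Rabs (ln m) + Rabs (ln M) + PI). intros z y Hz Hy Hey.
  assert (H1 : m <= Cmod (1 - z)).
  { unfold m. assert (A := Cmod_minus_ge 1 z). assert (B := Cmod_minus_ge z 1).
    rewrite Cmod_minus_sym in B. rewrite Cmod_1 in A, B. rewrite Hz in A, B.
    unfold Rabs in Hey. destruct (Rcase_abs y).
    - assert (Rpower q y <= Rpower q (- e)) by (apply Rle_Rpower; lra). lra.
    (* Outside the unit disc the natural bound is [q^e - 1]; it is at least [m] since a positive
       number and its inverse add up to at least 2. *)
    - assert (D : Rpower q e <= Rpower q y) by (apply Rle_Rpower; lra).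
      assert (E : Rpower q e * Rpower q (- e) = 1).
      { rewrite <- Rpower_plus, Rplus_opp_r. apply Rpower_O; lra. }
      assert (P := exp_pos (- e * ln q)). fold (Rpower q (- e)) in P.
      nra. }
  assert (H2 : Cmod (1 - z) <= M).
  { eapply Rle_trans; [apply Cmod_minus_le |]. rewrite Cmod_1, Hz.
    apply Rplus_le_compat_l. apply Rle_Rpower; lra. }
  eapply Rle_trans; [apply Cmod_le_re_im |]. unfold CLog, Re at 1, Im at 1; simpl.
  apply Rplus_le_compat.
  - assert (L1 := ln_le _ _ Hm H1).
    assert (L2 := ln_le _ _ (Rlt_le_trans _ _ _ Hm H1) H2).
    assert (A := Rle_abs (ln M)). assert (B := Rle_abs (- ln m)). rewrite Rabs_Ropp in B.
    assert (A' := Rabs_pos (ln M)). assert (B' := Rabs_pos (ln m)).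
    apply Rabs_le; lra.
  - unfold Carg. destruct (Rle_dec 0 _);
      assert (A := acos_bound (Re (1 - z) / Cmod (1 - z))); apply Rabs_le; lra.
Qed.

(** * Averages along an asymptotically exact family *)

Section Family.

Context (q : nat) (F : zeta_family q) (delta : nat -> R) (lambda : nat -> C)
  (q_ge_2 : 2 <= INR q) (hF : asymptotically_exact F delta lambda).

Let we := INR (essential_weight (fam_W F) delta).
(** The modulus of an inverse root of weight [we], hence the ratio dominating all essential
    coefficients. *)
Let B := Rpower (INR q) (we / 2).

Lemma dtot_eventually : eventually (fun k => 1 <= dtot F k).
Proof.
  destruct (proj2 (is_lim_seq_spec _ p_infty) (fam_degree q F) 1) as [K HK].
  exists K. intros k Hk. left. now apply HK.
Qed.

Lemma Cmod_div_dtot k (z : C) : 1 <= dtot F k ->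
  Cmod (z / RtoC (dtot F k)) = Cmod z / dtot F k.
Proof.
  intros Hk. unfold Cdiv.
  assert (H0 : RtoC (dtot F k) <> RtoC 0) by (intros E; apply RtoC_inj in E; lra).
  rewrite Cmod_mult, Cmod_inv, Cmod_R, Rabs_pos_eq by (exact H0 || lra). reflexivity.
Qed.

Lemma inessential_degree_vanishes :
  is_lim_seq (fun k => INR (total_degree (inessential_part delta (member F k))) / dtot F k) 0.
Proof.
  apply is_lim_seq_ext with
    (fun k => sum_n (fun i => INR (deg (inessential_part delta (member F k)) i) / dtot F k)
                    (fam_W F)).
  { intros k. rewrite INR_total_degree. unfold Rdiv.
    rewrite <- (sum_n_mult_r (K := R_Ring)). reflexivity. }
  (* The upper summation index is freed for induction, staying within the range where [delta] is a
     limit. *)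
  assert (H : forall n, (n <= fam_W F)%nat -> is_lim_seq
    (fun k => sum_n (fun i => INR (deg (inessential_part delta (member F k)) i) / dtot F k) n) 0).
  2:{ now apply H. }
  assert (H0 : forall i, (i <= fam_W F)%nat -> is_lim_seq
    (fun k => INR (deg (inessential_part delta (member F k)) i) / dtot F k) 0).
  { intros i Hi. unfold deg; simpl. destruct (Req_EM_T (delta i) 0) as [E | E].
    - rewrite <- E. exact (proj1 hF i Hi).
    - apply is_lim_seq_ext with (fun _ => 0); [| apply is_lim_seq_const].
      intros k. unfold Ldegree; simpl. unfold Rdiv; ring. }
  induction n as [|n IH]; intros Hn.
  - eapply is_lim_seq_ext; [| apply (H0 O Hn)]. intros k. now rewrite sum_O.
  - eapply is_lim_seq_ext; [intros k; symmetry; apply sum_Sn |].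
    replace (Finite 0) with (Finite (0 + 0)) by (f_equal; ring).
    apply (is_lim_seq_plus' _ _ 0 0); [apply IH; lia | apply (H0 (S n) Hn)].
Qed.

(** The sum is at most [M] times a number of roots that is negligible against [dtot]. Since [phi] is
    quantified after the threshold on [k], it may depend on [s] without spoiling uniformity. *)
Lemma inessential_root_sum_vanishes (M : R) (eta : posreal) :
  eventually (fun k => forall phi,
    (forall i rho, (i <= fam_W F)%nat -> delta i = 0 ->
       Cmod rho = Rpower (INR q) (- (INR i / 2)) -> Cmod (phi i rho) <= M) ->
    Cmod (root_sum (inessential_part delta (member F k)) phi / RtoC (dtot F k)) < eta).
Proof.
  (* [M] is an arbitrary real; [Rabs M + 1] is a positive upper bound for it. *)
  assert (Hm : 0 < eta / (Rabs M + 1)).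
  { apply Rdiv_lt_0_compat; [apply cond_pos | assert (A := Rabs_pos M); lra]. }
  destruct (proj2 (is_lim_seq_spec _ (Finite _)) inessential_degree_vanishes
    (mkposreal _ Hm)) as [K1 HK1].
  destruct dtot_eventually as [K2 HK2].
  exists (max K1 K2). intros k Hk phi Hphi.
  specialize (HK1 k ltac:(lia)). specialize (HK2 k ltac:(lia)). simpl in HK1.
  rewrite Cmod_div_dtot by exact HK2.
  set (N := INR (total_degree (inessential_part delta (member F k)))) in *.
  assert (HN : 0 <= N / dtot F k).
  { apply Rdiv_le_0_compat; [apply pos_INR | lra]. }
  rewrite Rminus_0_r, Rabs_pos_eq in HK1 by exact HN.
  assert (A := Rabs_pos M). assert (A' := Rle_abs M).
  apply Rle_lt_trans with ((Rabs M + 1) * (N / dtot F k)).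
  - unfold Rdiv. rewrite <- Rmult_assoc.
    apply Rmult_le_compat_r; [left; apply Rinv_0_lt_compat; lra |].
    apply Rle_trans with (M * N).
    + apply root_sum_le; [apply fam_eps_pm |].
      intros i rho Hi Hr. apply In_inessential_roots in Hr. now apply Hphi.
    + apply Rmult_le_compat_r; [apply pos_INR | lra].
  - apply Rmult_lt_compat_l with (r := Rabs M + 1) in HK1; [| lra].
    replace ((Rabs M + 1) * (eta / (Rabs M + 1))) with (pos eta) in HK1 by (field; lra).
    exact HK1.
Qed.

Lemma Cmod_inv_root_pow (w : R) (i n : nat) (rho : C) :
  INR i <= w -> Cmod rho = Rpower (INR q) (- (INR i / 2)) ->
  Cmod (- (/ rho) ^ n) <= Rpower (INR q) (w / 2) ^ n.
Proof.
  intros Hi Hr.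
  assert (Hp : 0 < Cmod rho) by (rewrite Hr; apply exp_pos).
  rewrite Cmod_opp, Cmod_pow, Cmod_inv by now apply Cmod_gt_0.
  apply pow_incr. split; [left; now apply Rinv_0_lt_compat |].
  rewrite Hr, <- Rpower_Ropp. apply Rle_Rpower; lra.
Qed.

(** The full coefficient is [Lambda], whose average tends to [lambda]; for a fixed index the
    inessential roots have bounded powers, so subtracting their share does not change the limit. *)
Lemma essential_root_coefs_limit (n : nat) (eps : posreal) :
  eventually (fun k => Cmod
    (root_coefs (essential_part delta (member F k)) (S n) / RtoC (dtot F k) - lambda (S n)) < eps).
Proof.
  assert (He : 0 < eps / 2) by (assert (A := cond_pos eps); lra).
  destruct (proj1 (filterlim_C_iff _ _) (proj2 hF (S n) ltac:(lia)) (mkposreal _ He))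
    as [K1 HK1].
  destruct (inessential_root_sum_vanishes (Rpower (INR q) (INR (fam_W F) / 2) ^ S n)
    (mkposreal _ He)) as [K2 HK2].
  exists (max K1 K2). intros k Hk.
  specialize (HK1 k ltac:(lia)). specialize (HK2 k ltac:(lia)). cbn [pos] in HK1, HK2.
  specialize (HK2 (fun _ rho => - (/ rho) ^ S n)%C).
  rewrite Lambda_roots in HK1 by exact q_ge_2.
  unfold root_coefs in *. rewrite (root_sum_split delta) in HK1.
  match type of HK2 with _ -> Cmod ?x < _ => set (I := x) in * end.
  assert (HI : Cmod I < eps / 2).
  { apply HK2. intros i rho Hi _ Hr. apply Cmod_inv_root_pow with i; [now apply le_INR | exact Hr]. }
  match type of HK1 with Cmod ?x < _ => set (J := x) in * end.
  match goal with |- Cmod ?x < _ => replace x with (J - I)%C end.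
  - eapply Rle_lt_trans; [apply Cmod_minus_le |]. lra.
  - unfold I, J, Cdiv. ring.
Qed.

Lemma essential_root_coefs_bound (k n : nat) : 1 <= dtot F k ->
  Cmod (root_coefs (essential_part delta (member F k)) n / RtoC (dtot F k)) <= B ^ n.
Proof.
  intros Hk. rewrite Cmod_div_dtot by exact Hk.
  assert (HB : 0 < B ^ n) by apply pow_lt, exp_pos.
  apply Rmult_le_reg_r with (dtot F k); [lra |].
  unfold Rdiv. rewrite Rmult_assoc, Rinv_l, Rmult_1_r by lra.
  eapply Rle_trans; [apply root_sum_le with (M := B ^ n); [apply fam_eps_pm |] |].
  - intros i rho Hi Hr. apply In_essential_roots in Hr. destruct Hr as [Hd Hr].
    apply Cmod_inv_root_pow with i; [| exact Hr].
    now apply le_INR, essential_weight_ge.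
  - apply Rmult_le_compat_l; [lra | apply essential_degree_le].
Qed.

(** The bound for the essential averages passes to the limit: a strict excess would contradict it at
    one large [k]. *)
Lemma lambda_bound (n : nat) : Cmod (lambda (S n)) <= B ^ S n.
Proof.
  apply Rnot_lt_le. intros Hlt.
  assert (He : 0 < Cmod (lambda (S n)) - B ^ S n) by lra.
  destruct (essential_root_coefs_limit n (mkposreal _ He)) as [K1 HK1].
  destruct dtot_eventually as [K2 HK2].
  specialize (HK1 (max K1 K2) ltac:(lia)). specialize (HK2 (max K1 K2) ltac:(lia)).
  assert (A := essential_root_coefs_bound _ (S n) HK2).
  rewrite Cmod_minus_sym in HK1.
  match type of HK1 with Cmod (?a - ?b) < _ => assert (D := Cmod_minus_ge a b) end.
  cbn [pos] in HK1. lra.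
Qed.

Lemma Cmod_div_INR_le (c : C) (n : nat) : Cmod (c / RtoC (INR (S n))) <= Cmod c.
Proof.
  assert (Hn : 1 <= INR (S n)) by (rewrite S_INR; assert (A := pos_INR n); lra).
  assert (Hn0 : (RtoC (INR (S n)) <> 0)%C).
  { intros E. apply RtoC_inj in E. lra. }
  unfold Cdiv. rewrite Cmod_mult, Cmod_inv, Cmod_R, Rabs_pos_eq by (exact Hn0 || lra).
  rewrite <- (Rmult_1_r (Cmod c)) at 2.
  apply Rmult_le_compat_l; [apply Cmod_ge_0 |].
  rewrite <- Rinv_1. apply Rinv_le_contravar; lra.
Qed.

(** [Series] has a meaning only once convergence is known. It follows here by comparison with the
    geometric series of ratio [r], because the coefficients are dominated by powers of [B]. *)
Lemma log_zeta_lim_series (s : C) : we / 2 < Re s ->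
  is_Cseries (dirichlet_term q lambda s) (log_zeta_lim q lambda s).
Proof.
  intros Hs.
  set (r := Rpower (INR q) (we / 2 - Re s)).
  assert (Hr : 0 < r < 1) by (split; [apply exp_pos | apply Rpower_lt_1; lra]).
  assert (Hg : ex_series (fun n => r * r ^ n)).
  { exists (r * / (1 - r)). apply (is_series_scal (V := R_NormedModule) r), is_series_geom.
    rewrite Rabs_pos_eq; lra. }
  assert (Hb : forall n, Cmod (dirichlet_term q lambda s n) <= r * r ^ n).
  { intros n. unfold dirichlet_term. rewrite qpow_mult, Cmod_mult, Cmod_pow, Cmod_qpow.
    apply Rle_trans with (B ^ S n * Rpower (INR q) (- Re s) ^ S n).
    - apply Rmult_le_compat_r; [apply pow_le; left; apply exp_pos |].
      eapply Rle_trans; [apply Cmod_div_INR_le | apply lambda_bound].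
    - rewrite <- Rpow_mult_distr. unfold B, r. rewrite <- Rpower_plus.
      right; reflexivity. }
  apply is_Cseries_iff.
  split; apply Series_correct; apply (ex_series_le (V := R_CompleteNormedModule)) with (2 := Hg);
    intros n; apply (fun H => Rle_trans _ _ _ H (Hb n)).
  - apply (re_le_Cmod (dirichlet_term q lambda s n)).
  - apply (Rabs_Im_le_Cmod (dirichlet_term q lambda s n)).
Qed.

Definition ess_average (k : nat) (s : C) : C :=
  (log_zeta (essential_part delta (member F k)) s / RtoC (dtot F k))%C.
Definition full_average (k : nat) (s : C) : C :=
  (log_zeta (member F k) s / RtoC (dtot F k))%C.

Lemma essential_uniform (e : R) : 0 < e ->
  uniform_cv (fun s => we / 2 + e <= Re s) ess_average (log_zeta_lim q lambda).
Proof.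
  intros He eta.
  assert (HB : 0 < B) by apply exp_pos.
  (* The exponent is halved because the ratio enters squared: its square divided by [B] is
     [q^{-(we / 2 + e)}], the largest value of [Cmod (qpow q s)] on the domain. *)
  assert (Hrho : 0 < Rpower (INR q) (- (e / 2)) < 1)
    by (split; [apply exp_pos | apply Rpower_lt_1; lra]).
  assert (Hdiv : forall a b c : C, (a / c - b / c = (a - b) / c)%C) by (intros; unfold Cdiv; ring).
  destruct dtot_eventually as [K0 HK0].
  destruct (uniform_tannery
    (fun k n => root_coefs (essential_part delta (member F k)) (S n) / RtoC (dtot F k)
                / RtoC (INR (S n)))%C
    (fun n => lambda (S n) / RtoC (INR (S n)))%C B _ HB Hrho) with (eta := eta) as [K1 HK1].
  - exists K0. intros k Hk n. eapply Rle_trans; [apply Cmod_div_INR_le |].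
    now apply essential_root_coefs_bound, HK0.
  - intros n. eapply Rle_trans; [apply Cmod_div_INR_le | apply lambda_bound].
  - intros n eps. destruct (essential_root_coefs_limit n eps) as [K HK].
    exists K. intros k Hk. rewrite Hdiv.
    eapply Rle_lt_trans; [apply Cmod_div_INR_le | now apply HK].
  - exists K1. intros k Hk s Hs. apply (HK1 k Hk (qpow q s)).
    + rewrite Cmod_qpow. unfold B, Rdiv.
      rewrite <- Rpower_Ropp. simpl. rewrite Rmult_1_r, <- !Rpower_plus.
      apply Rle_Rpower; lra.
    + replace (ess_average k s) with
        (/ RtoC (dtot F k) * log_zeta (essential_part delta (member F k)) s)%C
        by (unfold ess_average, Cdiv; ring).
      eapply is_Cseries_ext.
      2:{ apply is_Cseries_scal, log_zeta_series.
          intros i rho Hi Hr. apply In_essential_roots in Hr. destruct Hr as [Hd Hr].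
          rewrite (Cmod_qpow_div q i s rho q_ge_2 Hr). apply Rpower_lt_1; [lra |].
          assert (A := le_INR _ _ (essential_weight_ge _ delta i Hi Hd)). fold we in A. lra. }
      intros n. unfold dirichlet_term. rewrite qpow_mult. unfold Cdiv. ring.
    + eapply is_Cseries_ext; [| apply log_zeta_lim_series; lra].
      intros n. unfold dirichlet_term. now rewrite qpow_mult.
Qed.

(** The full and essential averages differ by the inessential logarithms. The gap from the abscissae
    [i / 2] and the sign of [Re s] give these one bound [M] on all of [D], so their average vanishes
    uniformly. *)
Lemma full_uniform (D : C -> Prop) (e : R) : 0 < e ->
  uniform_cv D ess_average (log_zeta_lim q lambda) ->
  (forall s, D s -> 0 <= Re s) ->
  (forall s i, D s -> (i <= fam_W F)%nat -> delta i = 0 -> e <= Rabs (INR i / 2 - Re s)) ->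
  uniform_cv D full_average (log_zeta_lim q lambda).
Proof.
  intros He Hess Hpos Hgap eta.
  assert (H2 : 0 < eta / 2) by (assert (A := cond_pos eta); lra).
  destruct (CLog_bound (INR q) (INR (fam_W F) / 2) e ltac:(lra) He) as [M HM].
  destruct (Hess (mkposreal _ H2)) as [K1 HK1].
  destruct (inessential_root_sum_vanishes M (mkposreal _ H2)) as [K2 HK2].
  exists (max K1 K2). intros k Hk s Hs.
  specialize (HK1 k ltac:(lia) s Hs).
  specialize (HK2 k ltac:(lia) (fun _ rho => CLog (1 - qpow q s / rho))%C).
  cbn [pos] in HK1, HK2.
  unfold full_average. change (log_zeta (member F k) s) with
    (root_sum (member F k) (fun _ rho => CLog (1 - qpow q s / rho))%C).
  rewrite (root_sum_split delta).
  match type of HK2 with _ -> Cmod ?x < _ => set (I := x) in * end.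
  assert (HI : Cmod I < eta / 2).
  { apply HK2. intros i rho Hi Hd Hr.
    apply (HM _ _ (Cmod_qpow_div q i s rho q_ge_2 Hr)).
    - specialize (Hpos s Hs). apply le_INR in Hi. lra.
    - now apply Hgap. }
  match type of HK1 with Cmod ?x < _ => set (J := x) in * end.
  match goal with |- Cmod ?x < _ => replace x with (J + I)%C end.
  - eapply Rle_lt_trans; [apply Cmod_triangle |]. lra.
  - unfold I, J, ess_average, Cdiv.
    change (log_zeta (essential_part delta (member F k)) s) with
      (root_sum (essential_part delta (member F k)) (fun _ rho => CLog (1 - qpow q s / rho))%C).
    unfold Cdiv. ring.
Qed.

End Family.

(** * From uniform estimates to the three claims *)

Lemma uniform_cv_mono (D D' : C -> Prop) f g :
  (forall s, D s -> D' s) -> uniform_cv D' f g -> uniform_cv D f g.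
Proof.
  intros H HU eta. destruct (HU eta) as [K HK]. exists K. intros k Hk s Hs. auto.
Qed.

Lemma uniform_cv_pointwise (D : C -> Prop) f g s :
  D s -> uniform_cv D f g -> filterlim (fun k => f k s) eventually (locally (g s)).
Proof.
  intros Hs HU. apply filterlim_C_iff. intros eps.
  destruct (HU eps) as [K HK]. exists K. auto.
Qed.

(** The nearest integers on either side of [x] are [up x - 1] and [up x], so the smaller of two
    positive distances works. *)
Lemma distance_to_integers (x : R) : ~ (exists n : Z, x = IZR n) ->
  exists d, 0 < d /\ forall n : Z, d <= Rabs (IZR n - x).
Proof.
  intros Hx. destruct (archimed x) as [Hu Hl].
  set (m := up x) in *.
  assert (Hm : x <> IZR (m - 1)) by (intros E; apply Hx; now exists (m - 1)%Z).
  rewrite minus_IZR in Hm.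
  exists (Rmin (IZR m - x) (x - (IZR m - 1))). split.
  - apply Rmin_glb_lt; lra.
  - intros n. destruct (Z_le_gt_dec m n) as [H | H].
    + apply IZR_le in H. eapply Rle_trans; [apply Rmin_l |].
      rewrite Rabs_pos_eq; lra.
    + assert (H' : (n <= m - 1)%Z) by lia. apply IZR_le in H'. rewrite minus_IZR in H'.
      eapply Rle_trans; [apply Rmin_r |].
      rewrite Rabs_left1; lra.
Qed.

Theorem mainTheorem7 (q : nat) (hq : prime_power q) (F : zeta_family q)
    (delta : nat -> R) (lambda : nat -> C)
    (hF : asymptotically_exact F delta lambda) :
  let we := INR (essential_weight (fam_W F) delta) in
  let ess := fun (k : nat) (s : C) =>
    (log_zeta (essential_part delta (member F k)) s / RtoC (dtot F k))%C in
  let full := fun (k : nat) (s : C) =>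
    (log_zeta (member F k) s / RtoC (dtot F k))%C in
  (forall s : C, we / 2 < Re s ->
     @is_series C_AbsRing C_NormedModule (dirichlet_term q lambda s)
       (log_zeta_lim q lambda s) /\
     filterlim (fun k => ess k s) eventually
       (locally (log_zeta_lim q lambda s))) /\
  (forall s : C, we / 2 < Re s -> ~ (exists n : Z, 2 * Re s = IZR n) ->
     filterlim (fun k => full k s) eventually
       (locally (log_zeta_lim q lambda s))) /\
  (forall e : R, 0 < e < 1 / 2 ->
     let D := fun s : C => we / 2 + e < Re s < (we + 1) / 2 - e in
     uniform_cv D ess (log_zeta_lim q lambda) /\
     uniform_cv D full (log_zeta_lim q lambda)).
Proof.
  intros we ess full.
  assert (Hq := prime_power_ge_2 q hq).
  assert (Hwe : 0 <= we) by apply pos_INR.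
  assert (Hess : forall e, 0 < e ->
    uniform_cv (fun s => we / 2 + e <= Re s) ess (log_zeta_lim q lambda))
    by exact (essential_uniform q F delta lambda Hq hF).
  assert (Hfull := full_uniform q F delta lambda Hq hF).
  split; [| split].
  - intros s Hs. split; [now apply (log_zeta_lim_series q F delta lambda Hq hF) |].
    (* The margin is chosen so that [s] lies on the boundary of the closed half-plane of uniform
       convergence. *)
    apply (uniform_cv_pointwise _ ess _ s) with (2 := Hess (Re s - we / 2) ltac:(lra)). lra.
  - intros s Hs Hn. destruct (distance_to_integers _ Hn) as [d [Hd Hdist]].
    (* Pointwise convergence is treated as uniform convergence on a single point. *)
    apply (uniform_cv_pointwise (fun s' => s' = s) full _ s eq_refl).
    (* Halved since [d] measures the distance from [2 * Re s] to the integers, while the gap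
       concerns [Re s] and [i / 2]. *)
    apply (Hfull _ (d / 2)); [lra | | |].
    + apply uniform_cv_mono with (2 := Hess (Re s - we / 2) ltac:(lra)).
      intros s' ->. lra.
    + intros s' ->. lra.
    + intros s' i -> Hi _. specialize (Hdist (Z.of_nat i)). rewrite <- INR_IZR_INZ in Hdist.
      replace (INR i - 2 * Re s) with (2 * (INR i / 2 - Re s)) in Hdist by field.
      rewrite Rabs_mult, (Rabs_pos_eq 2) in Hdist; lra.
  - intros e He D.
    assert (HD : uniform_cv D ess (log_zeta_lim q lambda)).
    { apply uniform_cv_mono with (2 := Hess e ltac:(lra)). unfold D. intros s Hs. lra. }
    split; [exact HD |].
    apply (Hfull D e); [lra | exact HD | unfold D; intros s Hs; lra |].
    intros s i Hs Hi Hd. unfold D in Hs. unfold we in Hs.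
    set (w := essential_weight (fam_W F) delta) in *.
    (* The strip lies between the consecutive abscissae [w / 2] and [(w + 1) / 2] with margin [e],
       so no [i / 2] comes closer than [e]. *)
    destruct (Nat.le_gt_cases i w) as [H | H].
    + apply le_INR in H. rewrite Rabs_left1; lra.
    + apply le_INR in H. rewrite S_INR in H. rewrite Rabs_pos_eq; lra.
Qed.
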